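(* Let $d \geq 3$ be an integer and $p > 1$ a real number such that $\frac{d-3}{2} - \frac{2}{p-1} < 0$, let $m\ge 1$ be a natural number, and let $F\colon \mathbb{R}^m \to \mathbb{R}$ be a defocusing potential that is homogeneous of order $p+1$. Let $\Gamma_d := \{ (t,x) \in \mathbb{R}^{1+d}: t>0,\ |x| \leq t \}$. Then there does not exist a smooth function $u\colon \Gamma_d \to \mathbb{R}^m \setminus \{0\}$ which solves $\Box u = (\nabla_{\mathbb{R}^m} F)(u)$ on $\Gamma_d$ and is homogeneous of order $-\frac{2}{p-1}$, that is, satisfies $u(\lambda t,\lambda x)=\lambda^{-\frac{2}{p-1}}u(t,x)$ for all $\lambda>0$ and $(t,x)\in\Gamma_d$.
   Context: Points of $\mathbb{R}^{1+d}$ are written $(t,x)$ with $t\in\mathbb{R}$, $x\in\mathbb{R}^d$; $|x|$ is the Euclidean norm; $\Box := -\partial_t^2 + \sum_{i=1}^d \partial_{x_i}^2$ acts componentwise. A potential is a function $F\colon\mathbb{R}^m\to\mathbb{R}$ that is smooth away from the origin. It is defocusing if $F(v)>0$ for all $v\ne0$, and homogeneous of order $\alpha$ if $F(\lambda v)=\lambda^\alpha F(v)$ for all $\lambda>0$ and $v\in\mathbb{R}^m$. Smoothness of $u$ on $\Gamma_d$ means smoothness all the way up to the boundary $|x|=t$, $t>0$. *)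

(* Defs.v *)
From HB Require Import structures.
From mathcomp Require Import all_boot all_order all_algebra.
From mathcomp Require Import all_classical all_reals all_analysis.

Set Implicit Arguments.
Unset Strict Implicit.
Unset Printing Implicit Defensive.

Import Order.TTheory GRing.Theory Num.Theory.
Import numFieldNormedType.Exports.

Local Open Scope classical_set_scope.
Local Open Scope ring_scope.

Section Smoothness.
Context {R : realType} {n : nat} {W : normedModType R}.
Implicit Types (f g : 'rV[R]_n -> W) (z : 'rV[R]_n) (A U : set 'rV[R]_n).

Definition partial (i : 'I_n) f : 'rV[R]_n -> W :=
  fun z => 'D_(delta_mx 0 i) f z.

Definition iter_partial (s : seq 'I_n) f : 'rV[R]_n -> W :=
  foldr partial f s.

(* Only meant for open [U]: ['D_v f z] looks at a full neighbourhood of [z]. *)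
Definition smooth_on_open U f : Prop :=
  forall (s : seq 'I_n) z, U z ->
    {for z, continuous (iter_partial s f)} /\
    forall i : 'I_n, derivable (iter_partial s f) z (delta_mx 0 i).

Definition smooth_extension_at A f z g : Prop :=
  exists U, [/\ open U, U z, smooth_on_open U g &
    forall y, U y -> A y -> g y = f y].

(* Smoothness on an arbitrary set, in the sense of manifolds with boundary. *)
Definition smooth_on A f : Prop :=
  forall z, A z -> exists g, smooth_extension_at A f z g.

End Smoothness.

Section Wave.
Context {R : realType}.

Definition enorm n (x : 'rV[R]_n) : R := Num.sqrt (\sum_i x 0 i ^+ 2).

(* A point (t, x) of R^(1+d) is the row vector with first entry t, followed by
   the entries of x. *)
Definition time_of d (z : 'rV[R]_(1 + d)) : R := z 0 (lshift d ord0).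
Definition space_of d (z : 'rV[R]_(1 + d)) : 'rV[R]_d := rsubmx z.

Definition Gamma d : set 'rV[R]_(1 + d) :=
  [set z | 0 < time_of z /\ enorm (space_of z) <= time_of z].

Definition box d m (u : 'rV[R]_(1 + d) -> 'rV[R]_m) (z : 'rV[R]_(1 + d)) :
    'rV[R]_m :=
  - partial (lshift d ord0) (partial (lshift d ord0) u) z
  + \sum_(i < d) partial (rshift 1 i) (partial (rshift 1 i) u) z.

Definition grad m (F : 'rV[R]_m -> R) (v : 'rV[R]_m) : 'rV[R]_m :=
  \row_j partial j (F : 'rV[R]_m -> R^o) v.

Definition potential m (F : 'rV[R]_m -> R) : Prop :=
  smooth_on_open [set v | v != 0] (F : 'rV[R]_m -> R^o).

Definition defocusing m (F : 'rV[R]_m -> R) : Prop :=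
  forall v, v != 0 -> 0 < F v.

Definition homogeneous m (alpha : R) (F : 'rV[R]_m -> R) : Prop :=
  forall (lambda : R) v, 0 < lambda ->
    F (lambda *: v) = lambda `^ alpha * F v.

(* At a boundary point of [Gamma d] the derivatives of [u] are those of a smooth
   local extension; they do not depend on the extension, because [Gamma d] lies
   in the closure of its interior. *)
Definition solves_wave d m (F : 'rV[R]_m -> R)
    (u : 'rV[R]_(1 + d) -> 'rV[R]_m) : Prop :=
  forall z, Gamma z -> exists2 g, smooth_extension_at (@Gamma d) u z g &
    box g z = grad F (u z).

Definition homogeneous_on_Gamma d m (alpha : R)
    (u : 'rV[R]_(1 + d) -> 'rV[R]_m) : Prop :=
  forall (lambda : R) z, 0 < lambda -> Gamma z ->
    u (lambda *: z) = lambda `^ alpha *: u z.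

End Wave.
Arguments Gamma {R} d.

(* Main.v *)
Require Import Defs.
From HB Require Import structures.
From mathcomp Require Import all_boot all_order all_algebra.
From mathcomp Require Import all_classical all_reals all_analysis.
From mathcomp Require Import ring lra.

Set Implicit Arguments.
Unset Strict Implicit.
Unset Printing Implicit Defensive.

Import Order.TTheory GRing.Theory Num.Theory.
Import numFieldNormedType.Exports.

Local Open Scope classical_set_scope.
Local Open Scope ring_scope.

(* Put k = 2/(p-1). On the compact slice t = 1, |x| <= 1 of the cone, |u|^2 has a
   maximum, say at (1, x). Homogeneity expresses the time derivatives of u by
   space derivatives and turns the wave equation into
     sum_ij (delta_ij - x_i x_j) D_ij u - 2(k+1) x.grad u - k(k+1) u = grad F(u),
   which degenerates exactly in the radial direction on the boundary. Let a_i be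
   the rows of the square root of 1 - x^T x and
   beta_i = |a_i|^2 (k+1)/(d - |x|^2), so that sum_i 2 beta_i = 2(k+1). If
   |x| < 1, the curves x + s a_i - s^2 beta_i x stay in the ball for small s. If
   |x| = 1, a_i is tangent to the sphere and the curve stays in the ball since
   2 beta_i > |a_i|^2 unless a_i = 0, because 2(k+1) > d - 1 by the hypothesis on
   p. Hence the second derivative of |u|^2 along each curve is nonpositive at
   s = 0; summing over i, the dot product of u with the left-hand side of the
   equation without its last term is at most 0, so
   u.grad F(u) + k(k+1)|u|^2 <= 0. But u.grad F(u) = (p+1) F(u) > 0. *)

(** * Mean value inequality and derivatives along lines *)

Section MeanValue.
Context {R : realType}.

(** The symmetric range |s| <= |a| lets one statement serve both signs of [a]; the mean value
    theorem is applied on [0, a] or on [a, 0]. *)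
Lemma mvt_ineq (f df : R -> R) (a e : R) :
  (forall s : R, `|s| <= `|a| -> is_derive s 1 f (df s)) ->
  (forall s, `|s| <= `|a| -> `|df s| <= e) ->
  `|f a - f 0| <= e * `|a|.
Proof.
move=> dfP dfe.
have cont (I : set R) : (forall s, I s -> `|s| <= `|a|) -> {within I, continuous f}.
  move=> Ile; apply: continuous_in_subspaceT => s /set_mem /Ile /dfP [ds _].
  by apply: differentiable_continuous; exact/derivable1_diffP.
have [a0|a0] := leP 0 a.
  have le_a s : 0 <= s -> s <= a -> `|s| <= `|a| by move=> ? ?; rewrite !ger0_norm.
  have [||c] := @MVT_segment _ f df _ _ a0.
  - by move=> s; rewrite in_itv/= => /andP[s0 sa]; apply: dfP; rewrite le_a ?ltW.
  - by apply: cont => s /=; rewrite in_itv/= => /andP[s0 sa]; exact: le_a.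
  rewrite in_itv/= => /andP[c0 ca] ->.
  by rewrite subr0 normrM ler_wpM2r// dfe// le_a.
have le_a s : a <= s -> s <= 0 -> `|s| <= `|a|.
  by move=> ? ?; rewrite !ler0_norm ?lerN2// ltW.
have [||c] := @MVT_segment _ f df _ _ (ltW a0).
- by move=> s; rewrite in_itv/= => /andP[s0 sa]; apply: dfP; rewrite le_a ?ltW.
- by apply: cont => s /=; rewrite in_itv/= => /andP[s0 sa]; exact: le_a.
rewrite in_itv/= => /andP[c0 ca] fE.
rewrite distrC fE sub0r mulrN normrN normrM ler_wpM2r// dfe// le_a//.
Qed.

End MeanValue.

Lemma is_derive_line {R : realType} {V W : normedModType R} (f : V -> W)
    (v z : V) (s : R) :
  derivable f (s *: v + z) v ->
  is_derive s 1 (fun s => f (s *: v + z)) ('D_v f (s *: v + z)).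
Proof.
move=> df.
have E : (fun h : R => h^-1 *: (((fun s => f (s *: v + z)) \o shift s) (h *: 1)
      - f (s *: v + z))) =
    (fun h => h^-1 *: ((f \o shift (s *: v + z)) (h *: v) - f (s *: v + z))).
  apply/funext => h /=.
  by rewrite [h *: 1]mulr1 scalerDl addrA.
by apply: DeriveDef; [rewrite /derivable E|rewrite /derive E].
Qed.

(** * Continuous partial derivatives imply differentiability *)

Section ContinuousPartials.
Context {R : realType} {n : nat}.
Implicit Types (f : 'rV[R]_n -> R) (z h : 'rV[R]_n).

(** Shifted by [z], these are the corners of a path from [z] to [h + z] that moves one coordinate at
    a time. *)
Let trunc h k : 'rV[R]_n := \row_j (if (j < k)%N then h 0 j else 0).

Lemma rv_norm_le h e : 0 <= e -> (`|h| <= e) = [forall j, `|h 0 j| <= e].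
Proof.
move=> e0; apply/idP/forallP => [he j|he].
  apply: le_trans he; rewrite /Num.norm/= mx_normrE.
  exact: (le_bigmax _ (fun ij : 'I_1 * 'I_n => `|h ij.1 ij.2|) (ord0, j)).
by rewrite /Num.norm/= mx_normrE bigmax_le//= => -[i j] _ /=; rewrite ord1.
Qed.

(** The increment of [f] telescopes over the corners [trunc h k + z]. On each edge [f] minus its
    linear part has a small derivative, because the partials are close to their values at [z], so
    the mean value inequality applies. *)
Lemma partials_linear_approx f z e :
  (\forall y \near z, forall i, derivable (f : _ -> R^o) y (delta_mx 0 i)) ->
  (forall i, {for z, continuous (partial i (f : _ -> R^o))}) ->
  0 < e ->
  \forall h \near (0 : 'rV[R]_n),
    `|f (h + z) - f z - \sum_i h 0 i * partial i (f : _ -> R^o) z| <= e * `|h|.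
Proof.
move=> df cf e0.
(* Each of the [n] edges may cost e / (n + 1), which adds up to at most [e]; n + 1 also makes sense
   for [n = 0]. *)
have n1_gt0 : 0 < n.+1%:R :> R by rewrite ltr0n.
have [r /= r0 rP] : exists2 r, 0 < r & forall y, `|y - z| < r ->
    forall i, derivable (f : _ -> R^o) y (delta_mx 0 i) /\
    `|partial i (f : _ -> R^o) y - partial i (f : _ -> R^o) z| <= e / n.+1%:R.
  have : \forall y \near z, forall i, derivable (f : _ -> R^o) y (delta_mx 0 i) /\
    `|partial i (f : _ -> R^o) y - partial i (f : _ -> R^o) z| <= e / n.+1%:R.
    have cf' : \forall y \near z, forall i,
        `|partial i (f : _ -> R^o) y - partial i (f : _ -> R^o) z| <= e / n.+1%:R.
      apply: (@filter_forall _ _ (fun i y => `|partial i (f : _ -> R^o) y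
        - partial i (f : _ -> R^o) z| <= e / n.+1%:R) (nbhs z) (nbhs_filter z)).
      move=> i; have /cvgrPdistC_le := cf i.
      by move=> /(_ _ (divr_gt0 e0 n1_gt0)).
    by apply: filterS2 df cf' => y dfy cfy i; split; [exact: dfy|exact: cfy].
  move=> /nbhs_normP[r /= r0 rP]; exists r => // y yz; apply: rP => /=.
  by rewrite distrC.
apply: filterS (nbhs0_lt r0) => h hr.
have step (k : 'I_n) :
    `|f (trunc h k.+1 + z) - f (trunc h k + z)
      - h 0 k * partial k (f : _ -> R^o) z| <= e / n.+1%:R * `|h|.
  pose L := partial k (f : _ -> R^o) z.
  pose g s := f (s *: delta_mx 0 k + (trunc h k + z)) - s * L.
  have -> : trunc h k.+1 + z = h 0 k *: delta_mx 0 k + (trunc h k + z).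
    rewrite addrA; congr (_ + _); apply/rowP => j; rewrite !mxE eqxx/= ltnS.
    rewrite leq_eqVlt (inj_eq val_inj); have [->|] := eqVneq j k.
      by rewrite ltnn mulr1 addr0.
    by rewrite mulr0 add0r.
  have g0 : g 0 = f (trunc h k + z) by rewrite /g scale0r add0r mul0r subr0.
  have bnd s : `|s| <= `|h 0 k| ->
      `|s *: delta_mx 0 k + (trunc h k + z) - z| < r.
    move=> sh; rewrite addrA addrK; apply: le_lt_trans hr.
    rewrite rv_norm_le//; apply/forallP => j; rewrite !mxE eqxx/=.
    have /forallP hj : [forall j, `|h 0 j| <= `|h|] by rewrite -rv_norm_le.
    have [->|_] := eqVneq j k.
      by rewrite ltnn mulr1 addr0 (le_trans sh).
    by rewrite mulr0 add0r; case: ifP => // _; rewrite normr0.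
  apply: (@le_trans _ _ (e / n.+1%:R * `|h 0 k|)); last first.
    rewrite ler_wpM2l ?divr_ge0 ?(ltW e0)//.
    have /forallP : [forall j, `|h 0 j| <= `|h|] by rewrite -rv_norm_le.
    exact.
  have -> : f (h 0 k *: delta_mx 0 k + (trunc h k + z)) - f (trunc h k + z)
      - h 0 k * partial k (f : _ -> R^o) z = g (h 0 k) - g 0.
    by rewrite g0 /g /L addrAC.
  apply: (@mvt_ineq _ g (fun s => partial k (f : _ -> R^o)
      (s *: delta_mx 0 k + (trunc h k + z)) - L)).
  - move=> s /bnd /rP /(_ k) [d _].
    apply: is_deriveB; first exact: is_derive_line.
    by apply: is_derive_eq; rewrite scaler0 add0r [_%:A]mulr1.
  - by move=> s /bnd /rP /(_ k) [_].
have h_trunc : trunc h n = h.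
  by apply/rowP => j; rewrite mxE ltn_ord.
have trunc0 : trunc h 0 = 0.
  by apply/rowP => j; rewrite !mxE.
have -> : f (h + z) - f z =
    \sum_(k < n) (f (trunc h k.+1 + z) - f (trunc h k + z)).
  rewrite -(big_mkord xpredT (fun k => f (trunc h k.+1 + z) - f (trunc h k + z))).
  by rewrite telescope_sumr// h_trunc trunc0 add0r.
rewrite -sumrB (le_trans (ler_norm_sum _ _ _))//.
rewrite (le_trans (ler_sum _ (fun k _ => step k)))// sumr_const card_ord.
rewrite -[leLHS]mulr_natl mulrA ler_wpM2r// mulrC mulrAC ler_pdivrMr//.
by rewrite ler_pM2l// ler_nat.
Qed.

End ContinuousPartials.

Section Differentiability.
Context {R : realType} {n : nat}.
Implicit Types (f : 'rV[R]_n -> R^o) (z h : 'rV[R]_n).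

Definition C1_at f z : Prop :=
  (\forall y \near z, forall i, derivable f y (delta_mx 0 i)) /\
  forall i, {for z, continuous (partial i f)}.

Definition gradient_form f z h : R^o := \sum_i h 0 i * partial i f z.

Lemma gradient_form_is_linear f z : linear (gradient_form f z).
Proof.
move=> a u v; rewrite /gradient_form scaler_sumr -big_split/=.
by apply: eq_bigr => i _; rewrite !mxE mulrDl -mulrA.
Qed.

HB.instance Definition _ f z :=
  GRing.isLinear.Build R 'rV[R]_n R^o *:%R (gradient_form f z)
    (gradient_form_is_linear f z).

Lemma continuous_gradient_form f z : continuous (gradient_form f z).
Proof.
apply: continuous_big => [|i _ h]; first exact: add_continuous.
by apply: (@continuousM R _ (fun x : 'rV[R]_n => x 0 i) (fun=> partial i f z) h); [exact: coord_continuous|exact: cst_continuous].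
Qed.

(** The estimate of [partials_linear_approx] is exactly the little-o remainder that characterises
    the differential. *)
Lemma C1_differentiable f z : C1_at f z ->
  differentiable f z /\ forall h, 'd f z h = gradient_form f z h.
Proof.
move=> [df cf].
have [cG fE] : continuous (gradient_form f z) /\
    f \o shift z = cst (f z) + gradient_form f z +o_ (0 : 'rV[R]_n) id.
  split; first exact: continuous_gradient_form.
  apply/eqaddoP => e e0.
  have := partials_linear_approx df cf e0; apply: filterS => h /=.
  by rewrite -[X in _ -> `|X| <= _]/(f (h + z) - (f z + gradient_form f z h))
    opprD addrA.
have dE := diff_unique cG fE.
split; last by move=> h; rewrite dE.
by apply/diff_locallyP; rewrite dE; split.
Qed.

Lemma is_derive_comp_C1 f (c : R -> 'rV[R]_n) dc (s : R) :
  C1_at f (c s) -> is_derive s 1 c dc ->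
  is_derive s 1 (f \o c) (gradient_form f (c s) dc).
Proof.
move=> /C1_differentiable[df dE] [dc1 dcE].
have dcs : differentiable c s by exact/derivable1_diffP.
have dfc : differentiable (f \o c) s by exact: differentiable_comp.
apply: DeriveDef; first exact/diff_derivable.
by rewrite deriveE// diff_comp//= dE -deriveE// dcE.
Qed.

End Differentiability.

(** * Second-order expansions of functions of one real variable *)

Section SecondOrderExpansion.
Context {R : realType}.
Implicit Types (f g : R -> R) (a b c e s : R).

Lemma near0P (P : R -> Prop) :
  (\forall s \near (0 : R), P s) <-> exists2 d, 0 < d & forall s, `|s| < d -> P s.
Proof. exact: (@nbhs_norm0P R R^o). Qed.

Lemma near0_le e : 0 < e -> \forall s \near (0 : R), `|s| <= e.
Proof. by move=> e0; apply/near0P; exists e => // s /ltW. Qed.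

(** An expansion with Peano remainder, so that [c] is half the second derivative. The bound includes
    s = 0, which forces [f 0 = a]. *)
Definition taylor2 f a b c : Prop :=
  forall e, 0 < e ->
  \forall s \near (0 : R), `|f s - (a + b * s + c * s ^+ 2)| <= e * s ^+ 2.

Lemma taylor2_at0 f a b c : taylor2 f a b c -> f 0 = a.
Proof.
move=> /(_ 1 ltr01) /nbhs_singleton.
rewrite expr0n/= !mulr0 !addr0 normr_le0 subr_eq0.
by move/eqP.
Qed.

(** Differentiability of [f1] at 0 bounds the derivative of [f] minus its quadratic polynomial by e
    |s|; the mean value inequality turns this into e s^2. *)
Lemma taylor2_derive f f1 c :
  (\forall s \near (0 : R), is_derive (s : R) 1 f (f1 s)) -> is_derive (0 : R) 1 f1 c ->
  taylor2 f (f 0) (f1 0) (c / 2).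
Proof.
move=> df [df1 f1c] e e0.
have [r /= r0 rP] : exists2 r, 0 < r & forall s : R, `|s| < r ->
    is_derive s 1 f (f1 s) /\ `|f1 s - f1 0 - c * s| <= e * `|s|.
  have f1e : \forall s \near (0 : R), `|f1 s - f1 0 - c * s| <= e * `|s|.
    have : h^-1 *: (f1 (h *: 1 + 0) - f1 0) @[h --> (0 : R)^'] --> c.
      by rewrite -f1c; exact: df1.
    move/cvgrPdistC_le => /(_ _ e0) [d /= d0 dP]; exists d => //= s sd.
    have [->|s0] := eqVneq s 0; first by rewrite mulr0 !subr0 subrr normr0 mulr0.
    have := dP s sd s0; rewrite addr0 [s *: 1]mulr1.
    have -> : f1 s - f1 0 - c * s = (s^-1 *: (f1 s - f1 0) - c) * s.
      by rewrite mulrBl /GRing.scale/= mulrAC mulVf// mul1r.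
    by move=> ?; rewrite normrM ler_wpM2r.
  have [d d0 dP] := (near0P _).1 (filterI df f1e).
  by exists d => // s sd; exact: dP.
apply/near0P; exists r => //= s sr.
pose g t := f t - (f1 0 * t + c / 2 * t ^+ 2).
have -> : f s - (f 0 + f1 0 * s + c / 2 * s ^+ 2) = g s - g 0 by rewrite /g; ring.
have -> : e * s ^+ 2 = (e * `|s|) * `|s| by rewrite -mulrA -expr2 real_normK ?num_real.
apply: (@mvt_ineq _ g (fun t => f1 t - f1 0 - c * t)) => t ts.
  have [dft _] := rP t (le_lt_trans ts sr).
  apply: is_derive_eq.
  by rewrite /GRing.scale/=; field.
have [_ h] := rP t (le_lt_trans ts sr); apply: (le_trans h).
by rewrite ler_wpM2l// ltW.
Qed.

Lemma eq_taylor2 f g a b c : f =1 g -> taylor2 f a b c -> taylor2 g a b c.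
Proof. by move=> /funext ->. Qed.

Lemma taylor2D f g a b c a' b' c' :
  taylor2 f a b c -> taylor2 g a' b' c' ->
  taylor2 (fun s => f s + g s) (a + a') (b + b') (c + c').
Proof.
move=> tf tg e e0.
have e2 : 0 < e / 2 by rewrite divr_gt0.
apply: filterS2 (tf _ e2) (tg _ e2) => s fs gs.
have -> : f s + g s - (a + a' + (b + b') * s + (c + c') * s ^+ 2) =
  (f s - (a + b * s + c * s ^+ 2)) + (g s - (a' + b' * s + c' * s ^+ 2)) by ring.
by rewrite (le_trans (ler_normD _ _))// (le_trans (lerD fs gs))// -mulrDl -splitr.
Qed.

Lemma taylor2_cst a : taylor2 (cst a) a 0 0.
Proof.
by move=> e e0; near=> s; rewrite !mul0r !addr0 subrr normr0 mulr_ge0 ?sqr_ge0 ?ltW.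
Unshelve. all: by end_near. Qed.

Lemma taylor2_sum (I : Type) (r : seq I) (f : I -> R -> R) (a b c : I -> R) :
  (forall i, taylor2 (f i) (a i) (b i) (c i)) ->
  taylor2 (fun s => \sum_(i <- r) f i s)
    (\sum_(i <- r) a i) (\sum_(i <- r) b i) (\sum_(i <- r) c i).
Proof.
move=> tf; elim: r => [|i r IH].
  rewrite !big_nil; apply: eq_taylor2 (taylor2_cst 0) => s; by rewrite big_nil.
rewrite !big_cons; apply: eq_taylor2 (taylor2D (tf i) IH) => s.
by rewrite big_cons.
Qed.

Lemma taylor2N f a b c : taylor2 f a b c ->
  taylor2 (fun s => - f s) (- a) (- b) (- c).
Proof.
move=> tf e e0; apply: filterS (tf _ e0) => s.
rewrite -normrN; congr (`|_| <= _); ring.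
Qed.

Lemma taylor2_oppx f a b c : taylor2 f a b c ->
  taylor2 (fun s => f (- s)) a (- b) c.
Proof.
move=> tf e e0; have [d d0 dP] := (near0P _).1 (tf e e0).
apply/near0P; exists d => //= s sd.
have := dP (- s); rewrite /= normrN => /(_ sd).
by rewrite sqrrN mulrN mulNr.
Qed.

Lemma taylor2M f g a b c a' b' c' :
  taylor2 f a b c -> taylor2 g a' b' c' ->
  taylor2 (fun s => f s * g s) (a * a') (a * b' + b * a')
    (a * c' + b * b' + c * a').
Proof.
move=> tf tg e e0.
pose F s := a + b * s + c * s ^+ 2; pose G s := a' + b' * s + c' * s ^+ 2.
pose A := `|a| + `|b| + `|c|; pose A' := `|a'| + `|b'| + `|c'|.
have poly_bound x y z : \forall s \near (0 : R),
    `|x + y * s + z * s ^+ 2| <= `|x| + `|y| + `|z|.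
  near=> s.
  have s1 : `|s| <= 1 by near: s; exact: near0_le.
  rewrite (le_trans (ler_normD _ _))// lerD//.
    rewrite (le_trans (ler_normD _ _))// lerD// normrM.
    by rewrite -[leRHS]mulr1 ler_wpM2l.
  by rewrite normrM normrX -[leRHS]mulr1 ler_wpM2l// exprn_ile1.
pose M := A + A' + `|b * c' + c * b'| + `|c * c'| + 1 + 1.
have A0 : 0 <= A by rewrite !addr_ge0.
have A'0 : 0 <= A' by rewrite !addr_ge0.
have M1 : 1 <= M by rewrite /M; have := normr_ge0 (b * c' + c * b');
  have := normr_ge0 (c * c'); lra.
have M0 : 0 < M by rewrite (lt_le_trans _ M1).
(* The error of the product splits into four terms, each at most e1 M s^2, hence at most a quarter
   of e s^2. The cap 1 keeps s^2 and the product of the two remainders under control. *)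
pose e1 := Num.min 1 (e / M / 4).
have e10 : 0 < e1 by rewrite /e1 lt_min ltr01 !divr_gt0.
near=> s.
have fs : `|f s - F s| <= e1 * s ^+ 2 by near: s; exact: tf.
have gs : `|g s - G s| <= e1 * s ^+ 2 by near: s; exact: tg.
have Fs : `|F s| <= A by near: s; exact: poly_bound.
have Gs : `|G s| <= A' by near: s; exact: poly_bound.
have se : `|s| <= e1 by near: s; exact: near0_le.
have e11 : e1 <= 1 by rewrite /e1 ge_min lexx.
have e1e : e1 * M <= e / 4.
  by rewrite -ler_pdivlMr// mulrAC /e1 ge_min lexx orbT.
have s1 : s ^+ 2 <= 1.
  by rewrite -real_normK ?num_real// exprn_ile1// (le_trans se).
have s0 : 0 <= s ^+ 2 by exact: sqr_ge0.
have -> : f s * g s - (a * a' + (a * b' + b * a') * s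
      + (a * c' + b * b' + c * a') * s ^+ 2) =
    (f s - F s) * G s + F s * (g s - G s) + (f s - F s) * (g s - G s)
    + ((b * c' + c * b') * s + c * c' * s * s) * s ^+ 2.
  by rewrite /F /G; ring.
have h1 : `|(f s - F s) * G s| <= e1 * s ^+ 2 * M.
  rewrite normrM ler_pM// (le_trans Gs)// /M.
  by have := normr_ge0 (b * c' + c * b'); have := normr_ge0 (c * c'); lra.
have h2 : `|F s * (g s - G s)| <= e1 * s ^+ 2 * M.
  rewrite normrM mulrC ler_pM// (le_trans Fs)// /M.
  by have := normr_ge0 (b * c' + c * b'); have := normr_ge0 (c * c'); lra.
have h3 : `|(f s - F s) * (g s - G s)| <= e1 * s ^+ 2 * M.
  rewrite normrM ler_pM// (le_trans gs)// (le_trans _ M1)//.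
  by rewrite -[leRHS]mulr1 ler_pM// ltW.
have h4 : `|((b * c' + c * b') * s + c * c' * s * s) * s ^+ 2|
    <= e1 * s ^+ 2 * M.
  rewrite normrM (ger0_norm s0) [leRHS]mulrAC ler_wpM2r//.
  rewrite (le_trans (ler_normD _ _))// !normrM.
  have h5 : `|b * c' + c * b'| * `|s| <= `|b * c' + c * b'| * e1 by rewrite ler_wpM2l.
  have h6 : `|c| * `|c'| * `|s| * `|s| <= `|c| * `|c'| * e1.
    rewrite -[leRHS]mulr1 ler_pM ?mulr_ge0// ?(le_trans se)//.
    by rewrite ler_wpM2l ?mulr_ge0.
  rewrite (le_trans (lerD h5 h6))// -mulrDl mulrC ler_wpM2l ?(ltW e10)//.
  by rewrite /M normrM; lra.
rewrite (le_trans (ler_normD _ _))//.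
have := ler_normD ((f s - F s) * G s + F s * (g s - G s)) ((f s - F s) * (g s - G s)).
have := ler_normD ((f s - F s) * G s) (F s * (g s - G s)).
have : e1 * s ^+ 2 * M <= e / 4 * s ^+ 2 by rewrite mulrAC ler_wpM2r.
lra.
Unshelve. all: by end_near. Qed.

(** If b > 0, the linear term beats the quadratic one and the remainder at small s > 0. Only s >= 0
    is considered, as needed for curves that leave the cone for s < 0. *)
Lemma taylor2_max_first f a b c : taylor2 f a b c ->
  (\forall s \near (0 : R), 0 <= s -> f s <= f 0) -> b <= 0.
Proof.
move=> tf fmax; rewrite leNgt; apply/negP => b0.
have [d d0 dP] := (near0P _).1 (filterI (tf _ ltr01) fmax).
(* The second bound makes (1 + |c|) s^2 at most half of b s, so [f s] exceeds [f 0]. *)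
pose s := Num.min (d / 2) (b / 2 / (1 + `|c|)).
have c0 : 0 < 1 + `|c| by rewrite ltr_pwDl.
have s0 : 0 < s by rewrite /s lt_min !divr_gt0.
have sd : `|s| < d.
  by rewrite gtr0_norm// /s gt_min ltr_pdivrMr// ltr_pMr// ltr1n.
have [] := dP s sd; rewrite (taylor2_at0 tf) => + /(_ (ltW s0)) fs.
rewrite ler_norml mul1r => /andP[h _].
have : s * (1 + `|c|) <= b / 2.
  by rewrite -ler_pdivlMr// /s ge_min lexx orbT.
move=> /(ler_wpM2l (ltW s0)).
have : - (`|c| * s ^+ 2) <= c * s ^+ 2.
  by rewrite -mulNr ler_wpM2r ?sqr_ge0// lerNl ler_normr lexx orbT.
have : 0 < s * b by rewrite mulr_gt0.
lra.
Qed.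

Lemma taylor2_max_second f a c : taylor2 f a 0 c ->
  (\forall s \near (0 : R), 0 <= s -> f s <= f 0) -> c <= 0.
Proof.
move=> tf fmax; rewrite leNgt; apply/negP => c0.
have c20 : 0 < c / 2 by rewrite divr_gt0.
have [d d0 dP] := (near0P _).1 (filterI (tf _ c20) fmax).
have s0 : 0 < d / 2 by rewrite divr_gt0.
have sd : `|d / 2| < d.
  by rewrite gtr0_norm// ltr_pdivrMr// ltr_pMr// ltr1n.
have [] := dP _ sd; rewrite (taylor2_at0 tf) => + /(_ (ltW s0)) fs.
rewrite ler_norml => /andP[h _].
have : 0 < c * (d / 2) ^+ 2 by rewrite mulr_gt0// exprn_gt0.
lra.
Qed.

Lemma taylor2_local_max f a b c : taylor2 f a b c ->
  (\forall s \near (0 : R), f s <= f 0) -> b = 0 /\ c <= 0.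
Proof.
move=> tf fmax.
have b0 : b = 0.
  apply/eqP; rewrite eq_le (taylor2_max_first tf)/=; last by apply: filterS fmax.
  rewrite -oppr_le0; apply: (taylor2_max_first (taylor2_oppx tf)).
  have [d d0 dP] := (near0P _).1 fmax; apply/near0P.
  by exists d => //= s sd _; rewrite oppr0; apply: dP; rewrite /= normrN.
split => //; rewrite b0 in tf; apply: (taylor2_max_second tf).
by apply: filterS fmax.
Qed.

(** Both f - g and g - f are constant for s >= 0, so 0 is a one-sided maximum of each; the first-
    and second-order tests give inequalities in both directions. *)
Lemma taylor2_unique f g a b c a' b' c' :
  taylor2 f a b c -> taylor2 g a' b' c' ->
  (\forall s \near (0 : R), 0 <= s -> f s = g s) ->
  [/\ a = a', b = b' & c = c'].
Proof.
move=> tf tg fg.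
have fg0 : f 0 = g 0 by exact: (nbhs_singleton fg).
have D1 := taylor2D tf (taylor2N tg).
have D2 := taylor2D tg (taylor2N tf).
have m1 : \forall s \near (0 : R), 0 <= s -> f s - g s <= f 0 - g 0.
  by apply: filterS fg => s /[swap] s0 ->//; rewrite fg0 !subrr.
have m2 : \forall s \near (0 : R), 0 <= s -> g s - f s <= g 0 - f 0.
  by apply: filterS fg => s /[swap] s0 ->//; rewrite fg0 !subrr.
have bE : b = b'.
  have := taylor2_max_first D1 m1; have := taylor2_max_first D2 m2.
  by rewrite !subr_le0 => ? ?; apply/eqP; rewrite eq_le; apply/andP.
rewrite bE subrr in D1 D2.
split => //; first by rewrite -(taylor2_at0 tf) -(taylor2_at0 tg).
have := taylor2_max_second D1 m1; have := taylor2_max_second D2 m2.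
by rewrite !subr_le0 => ? ?; apply/eqP; rewrite eq_le; apply/andP.
Qed.

Lemma taylor2_powR (k : R) :
  taylor2 (fun s => (1 + s) `^ k) 1 k (k * (k - 1) / 2).
Proof.
have near1 : \forall s \near (0 : R), 0 < 1 + s.
  apply/near0P; exists 1 => //= s; rewrite ltr_norml => /andP[+ _]; lra.
have dpow (l s : R) : (0 < 1 + s)%R ->
    is_derive (s : R) 1 (fun s : R => (1 + s) `^ l) (l * (1 + s) `^ (l - 1)).
  move=> s0.
  have E : (fun s : R => (1 + s) `^ l) = (@powR R ^~ l) \o shift 1.
    by apply/funext => t /=; rewrite addrC.
  rewrite E -[X in is_derive _ _ _ X]mulr1 [1 + s]addrC.
  apply: is_derive1_comp; last exact: is_derive_shift.
  by apply: is_derive1_powR; rewrite /= addrC.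
have := @taylor2_derive (fun s : R => (1 + s) `^ k)
  (fun s : R => k * (1 + s) `^ (k - 1)) (k * (k - 1)).
rewrite !addr0 !powR1 mulr1; apply; first by apply: filterS near1 => s; exact: dpow.
have d0 : is_derive (0 : R) 1 (fun s : R => (1 + s) `^ (k - 1)) (k - 1).
  by have := dpow (k - 1) 0; rewrite addr0 powR1 mulr1; apply.
exact: (is_deriveZ k d0).
Qed.

End SecondOrderExpansion.

(** * Second-order expansions along quadratic curves *)

Section ExpansionAlongCurves.
Context {R : realType} {n : nat}.
Implicit Types (f : 'rV[R]_n -> R^o) (z A B : 'rV[R]_n) (U : set 'rV[R]_n).

Definition hessian f z : 'M[R]_n := \matrix_(i, j) partial j (partial i f) z.

Definition hess_form f z A B : R := (A *m hessian f z *m B^T) 0 0.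

Lemma is_derive_quadratic_curve z A B (s : R) :
  is_derive s 1 (fun s : R => z + s *: A + s ^+ 2 *: B) (A + (2 * s) *: B).
Proof.
have dA : is_derive s 1 (fun s : R => z + s *: A) A.
  have -> : (fun s : R => z + s *: A) = (fun s : R => s *: A + z).
    by apply/funext => t; rewrite addrC.
  have := @is_derive_line R _ _ id A z s (@derivable_id _ _ _ _).
  by rewrite derive_id.
have dB : is_derive s 1 (fun s : R => s ^+ 2 *: B) ((2 * s) *: B).
  have d2 : differentiable (fun s : R => s ^+ 2) s.
    by apply/derivable1_diffP; exact: exprn_derivable.
  apply: DeriveDef.
    by apply/derivable1_diffP; exact: differentiableZl.
  rewrite deriveE; last exact: differentiableZl.
  rewrite diffZl//= -deriveE//; congr (_ *: _).
  by rewrite -derive1E exp_derive1 expr1.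
exact: is_deriveD.
Qed.

Lemma near_quadratic_curve U z A B : open U -> U z ->
  \forall s \near (0 : R), U (z + s *: A + s ^+ 2 *: B).
Proof.
move=> oU Uz; have := is_derive_quadratic_curve z A B 0.
set c := fun s : R => _ => -[dc _].
have cc : {for 0, continuous c}.
  by apply: differentiable_continuous; exact/derivable1_diffP.
apply: cc; rewrite /c expr0n/= !scale0r !addr0.
exact: open_nbhs_nbhs.
Qed.

Lemma smooth_C1_at U f s z : open U -> smooth_on_open U f -> U z ->
  C1_at (iter_partial s f) z.
Proof.
move=> oU sf Uz; split => [|i].
  apply: filterS (open_nbhs_nbhs (conj oU Uz)) => y Uy i.
  exact: (sf s y Uy).2.
exact: (sf (i :: s) z Uz).1.
Qed.

(** The chain rule is applied to [f] near s = 0, and at s = 0 once more to its partials. The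
    velocity A + 2 s B contributes twice the gradient along [B], and half of the second derivative
    is the last coefficient. *)
Lemma taylor2_curve U f z A B : open U -> smooth_on_open U f -> U z ->
  taylor2 (fun s => f (z + s *: A + s ^+ 2 *: B)) (f z)
    (gradient_form f z A)
    (gradient_form f z B + hess_form f z A A / 2).
Proof.
move=> oU sf Uz.
pose c (s : R) := z + s *: A + s ^+ 2 *: B.
have dc (s : R) : is_derive s 1 c (A + (2 * s) *: B).
  exact: is_derive_quadratic_curve.
have c0 : c 0 = z by rewrite /c expr0n/= !scale0r !addr0.
have Uc : \forall s \near (0 : R), U (c s) by exact: near_quadratic_curve.
pose f1 (s : R) : R := \sum_i (A 0 i + 2 * s * B 0 i) * partial i f (c s).
have df : \forall s \near (0 : R), is_derive (s : R) 1 (fun s => f (c s)) (f1 s).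
  apply: filterS Uc => s Ucs.
  have -> : f1 s = gradient_form f (c s) (A + (2 * s) *: B).
    by apply: eq_bigr => i _; rewrite !mxE.
  exact: (is_derive_comp_C1 (smooth_C1_at [::] oU sf Ucs) (dc s)).
pose f2 := \sum_i (A 0 i * gradient_form (partial i f) z A
  + 2 * B 0 i * partial i f z).
have df1 : is_derive (0 : R) 1 f1 f2.
  have -> : f1 = \sum_i (fun s : R => (A 0 i + 2 * s * B 0 i) * partial i f (c s)).
    by apply/funext => s; rewrite fct_sumE.
  apply: is_derive_sum => i.
  have dp : is_derive (0 : R) 1 (partial i f \o c) (gradient_form (partial i f) z A).
    have := is_derive_comp_C1 (c := c) (s := 0) (f := partial i f).
    rewrite c0 => /(_ _ (smooth_C1_at [:: i] oU sf Uz) (dc 0)).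
    by rewrite mulr0 scale0r addr0.
  have dl : is_derive (0 : R) 1 (fun s : R => A 0 i + 2 * s * B 0 i) (2 * B 0 i).
    have dA : is_derive (0 : R) 1 (fun s : R => A 0 i + s * (2 * B 0 i)) (2 * B 0 i).
      by apply: is_derive_eq; rewrite add0r mul1r scaler0 add0r [_%:A]mulr1.
    by have -> : (fun s : R => A 0 i + 2 * s * B 0 i) =
        (fun s : R => A 0 i + s * (2 * B 0 i)) by apply/funext => s; ring.
  have := is_deriveM dl dp.
  by rewrite /= c0 mulr0 mul0r addr0 /GRing.scale/= [partial i f z * _]mulrC.
have := taylor2_derive df df1.
rewrite c0.
have -> : f1 0 = gradient_form f z A.
  by apply: eq_bigr => i _; rewrite mulr0 mul0r addr0 c0.
suff -> : f2 / 2 = gradient_form f z B + hess_form f z A A / 2 by [].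
rewrite /f2 big_split/= mulrDl addrC; congr (_ + _).
  by rewrite mulr_suml; apply: eq_bigr => i _; field.
congr (_ * _); rewrite /hess_form -mulmxA mxE; apply: eq_bigr => i _.
congr (_ * _); rewrite mxE; by apply: eq_bigr => j _; rewrite !mxE mulrC.
Qed.

End ExpansionAlongCurves.

(** * Bilinearity of the Hessian, scaling, and the maximum test *)

Section FormAlgebra.
Context {R : realType} {n : nat}.
Implicit Types (f : 'rV[R]_n -> R^o) (z A B : 'rV[R]_n) (U : set 'rV[R]_n).

Lemma hess_formDl f z A B C :
  hess_form f z (A + B) C = hess_form f z A C + hess_form f z B C.
Proof. by rewrite /hess_form !mulmxDl mxE. Qed.

Lemma hess_formDr f z A B C :
  hess_form f z C (A + B) = hess_form f z C A + hess_form f z C B.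
Proof. by rewrite /hess_form linearD/= mulmxDr mxE. Qed.

Lemma hess_formZl f z (a : R) A C :
  hess_form f z (a *: A) C = a * hess_form f z A C.
Proof. by rewrite /hess_form -!scalemxAl mxE. Qed.

Lemma hess_formZr f z (a : R) A C :
  hess_form f z C (a *: A) = a * hess_form f z C A.
Proof. by rewrite /hess_form linearZ/= -scalemxAr mxE. Qed.

Lemma hess_form_suml (I : Type) (r : seq I) f z (F : I -> 'rV[R]_n) B :
  hess_form f z (\sum_(i <- r) F i) B = \sum_(i <- r) hess_form f z (F i) B.
Proof. by rewrite /hess_form !mulmx_suml summxE. Qed.

Lemma hess_form_sumr (I : Type) (r : seq I) f z (F : I -> 'rV[R]_n) B :
  hess_form f z B (\sum_(i <- r) F i) = \sum_(i <- r) hess_form f z B (F i).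
Proof. by rewrite /hess_form linear_sum mulmx_sumr summxE. Qed.

Lemma hess_form_subZ f z (a : R) A B :
  hess_form f z (A - a *: B) (A - a *: B) =
  hess_form f z A A - a * hess_form f z A B - a * hess_form f z B A
    + a ^+ 2 * hess_form f z B B.
Proof.
by rewrite -scaleNr hess_formDl !hess_formDr !hess_formZl !hess_formZr; ring.
Qed.

Lemma hess_form_delta f z i j :
  hess_form f z (delta_mx 0 i) (delta_mx 0 j) = partial j (partial i f) z.
Proof. by rewrite /hess_form -rowE trmx_delta -colE !mxE. Qed.

Lemma gradient_formZ f z (a : R) A :
  gradient_form f z (a *: A) = a * gradient_form f z A.
Proof. by rewrite linearZ. Qed.

(* Meant for [z = T + W] at time [1]: then [z + s T - s^2 W] equals
   [(1 + s) (z - s W)], and both points stay in the cone for [s >= 0]. *)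
Lemma second_derivative_scaling U f z (k : R) (T W : 'rV[R]_n) :
  open U -> smooth_on_open U f -> U z ->
  (\forall s \near (0 : R), 0 <= s ->
    f (z + s *: T + s ^+ 2 *: - W) = (1 + s) `^ (- k) * f (z - s *: W)) ->
  hess_form f z T T =
    hess_form f z W W + 2 * (k + 1) * gradient_form f z W + k * (k + 1) * f z.
Proof.
move=> oU sf Uz fs.
have t1 := taylor2_curve T (- W) oU sf Uz.
have t2 := taylor2M (taylor2_powR (- k)) (taylor2_curve (- W) 0 oU sf Uz).
(* Only the coefficients of s^2 matter; that of (1 + s)^(-k) is k (k + 1) / 2. *)
have [|_ _] := taylor2_unique t1 t2.
  by apply: filterS fs => s /[apply] ->; rewrite scaler0 addr0 scalerN.
rewrite linear0 -[- W]scaleN1r !hess_formZl !hess_formZr !gradient_formZ => h.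
lra.
Qed.

(** The s^2 coefficient of the sum of squares along the curve is nonpositive at a maximum. It equals
    the stated sum plus the squares of the gradients along [A], which are dropped. *)
Lemma sum_sqr_local_max (m : nat) U (G : 'I_m -> 'rV[R]_n -> R^o) z A B :
  open U -> (forall l, smooth_on_open U (G l)) -> U z ->
  (\forall s \near (0 : R), \sum_l G l (z + s *: A + s ^+ 2 *: B) ^+ 2
     <= \sum_l G l z ^+ 2) ->
  \sum_l G l z * (2 * gradient_form (G l) z B + hess_form (G l) z A A) <= 0.
Proof.
move=> oU sG Uz Gmax.
have t l := taylor2M (taylor2_curve A B oU (sG l) Uz) (taylor2_curve A B oU (sG l) Uz).
have tS := taylor2_sum (index_enum 'I_m) t.
have [|_] := taylor2_local_max tS.
  apply: filterS Gmax => s; rewrite expr0n/= !scale0r !addr0.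
  by under eq_bigr do rewrite expr2; under [leRHS]eq_bigr do rewrite expr2.
apply: le_trans; apply: ler_sum => l _.
by have := sqr_ge0 (gradient_form (G l) z A); lra.
Qed.

End FormAlgebra.

(** * Components of vector-valued maps, and Euler's identity *)

Section Components.
Context {R : realType} {n m : nat}.

Lemma iter_partial_component (U : set 'rV[R]_n) (g : 'rV[R]_n -> 'rV[R]_m)
    (l : 'I_m) (s : seq 'I_n) z :
  open U -> smooth_on_open U g -> U z ->
  iter_partial s (fun y => g y 0 l : R^o) z = iter_partial s g z 0 l.
Proof.
move=> oU sg; elim: s z => [//|i s IH] z Uz /=.
rewrite /partial derive_mx; last exact: (sg s z Uz).2.
rewrite mxE; apply: near_eq_derive.
by apply: filterS (open_nbhs_nbhs (conj oU Uz)) => y /IH.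
Qed.

Lemma smooth_on_open_component (U : set 'rV[R]_n) (g : 'rV[R]_n -> 'rV[R]_m)
    (l : 'I_m) :
  open U -> smooth_on_open U g -> smooth_on_open U (fun y => g y 0 l : R^o).
Proof.
move=> oU sg s z Uz.
have gE : \near z, iter_partial s g z 0 l = iter_partial s (fun y => g y 0 l : R^o) z.
  apply: filterS (open_nbhs_nbhs (conj oU Uz)) => y Uy.
  by rewrite (iter_partial_component l s oU sg Uy).
have [cg dg] := sg s z Uz.
split => [|i].
  have cgl : (iter_partial s g y 0 l) @[y --> z] --> iter_partial s g z 0 l.
    apply: (@cvg_comp _ _ _ (iter_partial s g) (fun M : 'rV[R]_m => M 0 l)) cg _.
    exact: coord_continuous.
  rewrite /prop_for/continuous_at -(nbhs_singleton gE).
  exact: cvg_trans (near_eq_cvg gE) cgl.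
apply: near_eq_derivable gE _.
exact: (derivable_mxP _ _ _).1 (dg i) 0 l.
Qed.

End Components.

(** Two expansions of F((1 + s) v), one by the chain rule and one by homogeneity, have the same
    coefficient of s. *)
Lemma euler_homogeneous {R : realType} {m : nat} (F : 'rV[R]_m -> R) (a : R) (v : 'rV[R]_m) :
  potential F -> homogeneous a F -> v != 0 ->
  \sum_j v 0 j * grad F v 0 j = a * F v.
Proof.
move=> sF hF v0.
have o0 : open [set v : 'rV[R]_m | v != 0].
  have -> : [set v : 'rV[R]_m | v != 0] = ~` [set 0].
    by apply/seteqP; split => x /= /eqP.
  apply: closed_openC; apply: accessible_closed_set1.
  by apply: hausdorff_accessible; exact: norm_hausdorff.
have t1 := taylor2_curve v 0 o0 sF v0.
have t2 := taylor2M (taylor2_powR a) (taylor2_cst (F v)).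
have [|_ + _] := taylor2_unique t1 t2.
  apply/near0P; exists 1 => // s; rewrite ltr_norml => /andP[s1 _] _.
  rewrite scaler0 addr0 -[X in F (X + _)]scale1r -scalerDl hF//.
  by lra.
rewrite mul1r add0r => <-.
by apply: eq_bigr => j _; rewrite mxE.
Qed.

(** * The cone, its compact slice, and inward-bending curves in the ball *)

Section LightCone.
Context {R : realType} {d : nat}.
Implicit Types (z : 'rV[R]_(1 + d)).

Lemma GammaE z : Gamma d z <->
  0 < z 0 (lshift d ord0) /\
  \sum_i z 0 (rshift 1 i) ^+ 2 <= z 0 (lshift d ord0) ^+ 2.
Proof.
rewrite /Gamma/= /time_of /enorm.
have -> : \sum_i space_of z 0 i ^+ 2 = \sum_i z 0 (rshift 1 i) ^+ 2.
  by apply: eq_bigr => i _; rewrite mxE.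
split=> -[t0 h]; split => //.
  rewrite -(@ler_sqrt _ _ (z 0 (lshift d ord0) ^+ 2)) ?sqr_ge0//.
  by rewrite sqrtr_sqr gtr0_norm.
by rewrite -(gtr0_norm t0) -sqrtr_sqr ler_wsqrtr.
Qed.

Lemma Gamma_scale (a : R) z : 0 < a -> Gamma d z -> Gamma d (a *: z).
Proof.
move=> a0 /GammaE[t0 h]; apply/GammaE; rewrite !mxE mulr_gt0//; split => //.
rewrite exprMn; under eq_bigr do rewrite mxE exprMn.
by rewrite -mulr_sumr ler_wpM2l// sqr_ge0.
Qed.

Definition cone_slice : set 'rV[R]_(1 + d) :=
  [set z | z 0 (lshift d ord0) = 1 /\ \sum_i z 0 (rshift 1 i) ^+ 2 <= 1].

Lemma cone_slice_Gamma z : cone_slice z -> Gamma d z.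
Proof. by move=> [t1 h]; apply/GammaE; rewrite t1 expr1n. Qed.

Lemma cone_slice_compact : compact cone_slice.
Proof.
apply: bounded_closed_compact.
  exists 1; split; first exact: num_real.
  move=> M M1 z [t1 h]; rewrite /= rv_norm_le ?(le_trans ler01 (ltW M1))//.
  apply/forallP => j; apply: le_trans (ltW M1).
  case: (split_ordP j) => i ->; first by rewrite (ord1 i) t1 normr1.
  rewrite -(@ler_sqr _ _ 1) ?nnegrE//= real_normK ?num_real// expr1n.
  apply: le_trans h; rewrite (bigD1 i)//= lerDl sumr_ge0// => k _.
  exact: sqr_ge0.
have -> : cone_slice = ((fun z : 'rV[R]_(1 + d) => z 0 (lshift d ord0)) @^-1` [set 1])
    `&` ((fun z => \sum_i z 0 (rshift 1 i) ^+ 2) @^-1` [set x | x <= 1]).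
  by [].
apply: closedI; apply: closed_comp.
- by move=> z _; exact: coord_continuous.
- exact: closed_eq.
- move=> z _; apply: continuous_big => [|i _ {}z]; first exact: add_continuous.
  apply: (@continuous_comp _ _ _ (fun z : 'rV[R]_(1 + d) => z 0 (rshift 1 i))
     (fun x => x ^+ 2)); first exact: coord_continuous.
  exact: exprn_continuous.
- exact: closed_le.
Qed.

Section Frame.
Variables (x : 'I_d -> R) (c : R).
Let r2 := \sum_i x i ^+ 2.
Hypotheses (r2_le1 : r2 <= 1) (cE : c ^+ 2 * r2 - 2 * c + 1 = 0).

(* [frame_coord i] is the [i]-th row of [1 - c x^T x], the square root of
   [1 - x^T x] for [c] as in [cE]. *)
Definition frame_coord (i j : 'I_d) : R := (j == i)%:R - c * x i * x j.

(** This is the radial component of the row. It vanishes on the sphere, where [cE] gives c = 1. *)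
Lemma sum_frame_coordM i : \sum_j x j * frame_coord i j = x i * (1 - c * r2).
Proof.
rewrite /frame_coord; under eq_bigr do rewrite mulrBr.
rewrite sumrB (bigD1 i)//= eqxx mulr1 big1 ?addr0; last first.
  by move=> j /negPf ->; rewrite mulr0.
rewrite mulrBr mulr1; congr (_ - _).
by rewrite /r2 mulrA mulr_sumr; apply: eq_bigr => j _; ring.
Qed.

(** A diagonal entry of (1 - c x^T x)^2 = 1 - (2 c - c^2 r2) x^T x, whose bracket is 1 by [cE]. *)
Lemma sum_frame_coord_sqr i :
  \sum_j frame_coord i j ^+ 2 = 1 - x i ^+ 2.
Proof.
have -> : \sum_j frame_coord i j ^+ 2 =
    \sum_j ((j == i)%:R * (1 - 2 * c * x i * x j)) + \sum_j c ^+ 2 * x i ^+ 2 * x j ^+ 2.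
  rewrite -big_split/=; apply: eq_bigr => j _; rewrite /frame_coord.
  by case: (j == i) => /=; ring.
rewrite (bigD1 i)//= eqxx mul1r big1 ?addr0; last first.
  by move=> j /negPf ->; rewrite mul0r.
rewrite -mulr_sumr -/r2.
have -> : c ^+ 2 * x i ^+ 2 * r2 = x i ^+ 2 * (c ^+ 2 * r2) by ring.
have -> : c ^+ 2 * r2 = 2 * c - 1 by apply/eqP; rewrite -subr_eq0 -cE; apply/eqP; ring.
by ring.
Qed.

(* On the sphere the rows are tangent to it, and [kappa > 1] makes the curve bend
   inwards faster than the sphere itself. *)
Lemma frame_curve_in_ball (kappa : R) i :
  (r2 = 1 -> 1 < kappa) ->
  \forall s \near (0 : R),
    \sum_j (x j + s * frame_coord i j
      - s ^+ 2 * (kappa / 2 * (1 - x i ^+ 2)) * x j) ^+ 2 <= 1.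
Proof.
move=> kappa1; set beta := kappa / 2 * _.
pose P s := r2 * (1 - s ^+ 2 * beta) ^+ 2
  + 2 * s * (1 - s ^+ 2 * beta) * (x i * (1 - c * r2)) + s ^+ 2 * (1 - x i ^+ 2).
have PE s : \sum_j (x j + s * frame_coord i j - s ^+ 2 * beta * x j) ^+ 2 = P s.
  rewrite /P -sum_frame_coordM -sum_frame_coord_sqr /r2 mulr_suml !mulr_sumr.
  by rewrite -!big_split/=; apply: eq_bigr => j _; ring.
(* In the open ball, continuity of [P] and P 0 = r2 < 1 are enough. *)
have [r1|r1] := eqVneq r2 1; last first.
  have r_lt1 : r2 < 1 by rewrite lt_neqAle r1.
  have cP : {for (0 : R), continuous P}.
    apply: differentiable_continuous; apply/derivable1_diffP.
    exact: ex_derive.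
  have P0 : P 0 = r2 by rewrite /P; ring.
  have : \forall s \near (0 : R), P s < 1.
    by have /cvgr_lt := cP; apply; rewrite P0.
  by apply: filterS => s /ltW; rewrite PE.
have c1 : c = 1.
  have : (c - 1) ^+ 2 = 0 by rewrite -cE r1; ring.
  by move=> /eqP; rewrite sqrf_eq0 subr_eq0 => /eqP.
(* Here the row and [beta] vanish, so the curve is constant. *)
have [xi1|xi1] := eqVneq (1 - x i ^+ 2) 0.
  near=> s; rewrite PE /P /beta xi1 r1 c1.
  suff -> : 1 * (1 - s ^+ 2 * (kappa / 2 * 0)) ^+ 2 + 2 * s * (1 - s ^+ 2 * (kappa / 2 * 0)) * (x i * (1 - 1 * 1)) + s ^+ 2 * 0 = 1 by [].
  by ring.
have xi_gt0 : 0 < 1 - x i ^+ 2.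
  rewrite lt_neqAle eq_sym xi1 subr_ge0 -r1 /r2 (bigD1 i)//= lerDl sumr_ge0//.
  by move=> k _; exact: sqr_ge0.
have k1 := kappa1 r1.
(* On the sphere P s = 1 - s^2 (kappa - 1) (1 - x_i^2) + s^4 beta^2, so s^2 <= e suffices. Adding 1
   to beta^2 gives room and a nonzero denominator. *)
pose e := (kappa - 1) * (1 - x i ^+ 2) / (1 + beta ^+ 2).
have b1 : 0 < 1 + beta ^+ 2 by rewrite ltr_pwDl// sqr_ge0.
have e0 : 0 < Num.min 1 e.
  by rewrite lt_min ltr01 divr_gt0// mulr_gt0// subr_gt0.
near=> s; rewrite PE /P r1 c1.
have s1 : `|s| <= Num.min 1 e by near: s; exact: near0_le.
have sle : s ^+ 2 <= e.
  move: s1; rewrite le_min => /andP[s1 se].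
  rewrite -real_normK ?num_real// expr2 (le_trans _ se)//.
  by rewrite -[leRHS]mul1r ler_wpM2r.
have : s ^+ 2 * (1 + beta ^+ 2) <= (kappa - 1) * (1 - x i ^+ 2).
  by rewrite -ler_pdivlMr.
move=> /(ler_wpM2l (sqr_ge0 s)).
have : 2 * beta = kappa * (1 - x i ^+ 2) by rewrite /beta; field.
have : 0 <= s ^+ 2 * s ^+ 2 by rewrite mulr_ge0 ?sqr_ge0.
move: (beta) (1 - x i ^+ 2) => b y s4 bE h.
suff : 1 * (1 - s ^+ 2 * b) ^+ 2 + 2 * s * (1 - s ^+ 2 * b) * (x i * (1 - 1 * 1)) + s ^+ 2 * y
  = 1 - s ^+ 2 * (2 * b - y) + s ^+ 2 * (s ^+ 2 * b ^+ 2).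
  by move=> ->; rewrite bE; lra.
by ring.
Unshelve. all: by end_near. Qed.

End Frame.
End LightCone.

(** * The maximum on the slice, and Hessians in the radial direction *)

Lemma smooth_on_cvg_within (R : realType) n m (A K : set 'rV[R]_n)
    (u : 'rV[R]_n -> 'rV[R]_m) z :
  K `<=` A -> smooth_on A u -> K z -> u y @[y --> within K (nbhs z)] --> u z.
Proof.
move=> KA su Kz; have [g [U [oU Uz sg gu]]] := su z (KA z Kz).
have ug : \forall y \near within K (nbhs z), g y = u y.
  rewrite near_withinE; apply: filterS (open_nbhs_nbhs (conj oU Uz)) => y Uy Ky.
  exact/gu/KA.
rewrite -(gu z Uz (KA z Kz)).
apply: cvg_trans (near_eq_cvg ug) _.
apply: cvg_within_filter; exact: (sg [::] z Uz).1.
Qed.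

Lemma cone_slice_max (R : realType) d m (u : 'rV[R]_(1 + d) -> 'rV[R]_m) :
  smooth_on (Gamma d) u ->
  exists2 z0, cone_slice z0 & forall z, cone_slice z ->
    \sum_l u z 0 l ^+ 2 <= \sum_l u z0 0 l ^+ 2.
Proof.
move=> su.
have [|||z0 z0K z0max] := @EVT_max_rV R _ (fun z => \sum_l u z 0 l ^+ 2) (@cone_slice R d).
(* The slice contains its centre (1, 0). *)
- exists (delta_mx 0 (lshift d ord0)); split; first by rewrite !mxE !eqxx.
  by rewrite big1// => i _; rewrite mxE eqxx eq_rlshift expr0n.
- exact: cone_slice_compact.
- apply/subspace_continuousP => z zK; apply: cvg_big => [|l _].
    exact: add_continuous.
  have ul : u y 0 l @[y --> within (@cone_slice R d) (nbhs z)] --> u z 0 l.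
    apply: (@cvg_comp _ _ _ u (fun M : 'rV[R]_m => M 0 l)).
      exact: (smooth_on_cvg_within (@cone_slice_Gamma R d) su zK).
    exact: coord_continuous.
  by under eq_fun do rewrite expr2; rewrite expr2; exact: cvgM.
by exists z0 => [|z zK]; [exact: set_mem|apply: z0max; exact: mem_set].
Qed.

Section RadialDirection.
Context {R : realType} {d : nat}.
Variable z0 : 'rV[R]_(1 + d).
Hypothesis z0K : cone_slice z0.

Let T : 'rV[R]_(1 + d) := delta_mx 0 (lshift d ord0).
(** As [z0] has time 1, this is the radial vector (0, x). *)
Let W := z0 - T.
Let x i := z0 0 (rshift 1 i).
Let r2 := \sum_i x i ^+ 2.

Lemma radialE : W = \sum_i x i *: delta_mx 0 (rshift 1 i).
Proof.
apply/rowP => j; rewrite /W summxE; case: (split_ordP j) => i ->.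
  rewrite (ord1 i) !mxE !eqxx/= z0K.1 subrr big1// => k _.
  by rewrite !mxE eqxx eq_lrshift mulr0.
rewrite !mxE eqxx eq_rlshift subr0 (bigD1 i)//= !mxE !eqxx mulr1.
rewrite big1 ?addr0// => k ki; rewrite !mxE eqxx eq_rshift eq_sym.
by rewrite (negPf ki) mulr0.
Qed.

Lemma radial_time : W 0 (lshift d ord0) = 0.
Proof. by rewrite !mxE !eqxx/= z0K.1 subrr. Qed.

Lemma radial_space i : W 0 (rshift 1 i) = x i.
Proof. by rewrite !mxE eqxx eq_rlshift subr0. Qed.

(** The [i]-th row of 1 - c x^T x as a vector of time component 0. *)
Let A c i : 'rV[R]_(1 + d) := delta_mx 0 (rshift 1 i) - (c * x i) *: W.

(** Expanding bilinearly, the mixed terms sum to multiples of the Hessian at (W, W), with total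
    coefficient c^2 r2 - 2 c = -1. *)
Lemma sum_hess_form_frame (c : R) (f : 'rV[R]_(1 + d) -> R^o) :
  c ^+ 2 * r2 - 2 * c + 1 = 0 ->
  \sum_i hess_form f z0 (A c i) (A c i) =
  \sum_i partial (rshift 1 i) (partial (rshift 1 i) f) z0 - hess_form f z0 W W.
Proof.
move=> cE.
pose e i : 'rV[R]_(1 + d) := delta_mx 0 (rshift 1 i).
have sumr B : \sum_i x i * hess_form f z0 (e i) B = hess_form f z0 W B.
  by rewrite radialE hess_form_suml; apply: eq_bigr => i _; rewrite hess_formZl.
have suml B : \sum_i x i * hess_form f z0 B (e i) = hess_form f z0 B W.
  by rewrite radialE hess_form_sumr; apply: eq_bigr => i _; rewrite hess_formZr.
transitivity (\sum_i (hess_form f z0 (e i) (e i)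
    - c * (x i * hess_form f z0 (e i) W) - c * (x i * hess_form f z0 W (e i))
    + c ^+ 2 * hess_form f z0 W W * x i ^+ 2)).
  by apply: eq_bigr => i _; rewrite hess_form_subZ; ring.
rewrite !big_split/= !sumrN -!mulr_sumr sumr suml -/r2.
under eq_bigr do rewrite hess_form_delta.
have -> : c ^+ 2 * hess_form f z0 W W * r2 = (c ^+ 2 * r2) * hess_form f z0 W W by ring.
have -> : c ^+ 2 * r2 = 2 * c - 1.
  by apply/eqP; rewrite -subr_eq0 -cE; apply/eqP; ring.
by ring.
Qed.

End RadialDirection.

Lemma quadratic_curve_coord (R : realType) n (z A V : 'rV[R]_n) (a b s : R) j :
  (z + s *: (A - a *: V) + s ^+ 2 *: (- b *: V)) 0 j =
  z 0 j + s * (A 0 j - a * V 0 j) - s ^+ 2 * b * V 0 j.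
Proof. by rewrite !mxE; ring. Qed.

(** * The nonexistence theorem *)

Theorem proposition2p2 (R : realType) (d m : nat) (p : R)
    (F : 'rV[R]_m -> R)
    (hd : (3 <= d)%N) (hm : (1 <= m)%N) (hp : 1 < p)
    (hdp : (d%:R - 3) / 2 - 2 / (p - 1) < 0)
    (hF : potential F) (hFpos : defocusing F)
    (hFhom : homogeneous (p + 1) F) :
  ~ exists u : 'rV[R]_(1 + d) -> 'rV[R]_m,
      [/\ smooth_on (Gamma d) u,
          forall z, Gamma d z -> u z != 0,
          solves_wave F u &
          homogeneous_on_Gamma (- (2 / (p - 1))) u].
Proof.
move=> [u [su u0 hw hu]]; set k := 2 / (p - 1) in hdp hu.
have k0 : 0 < k by rewrite divr_gt0// subr_gt0.
have [z0 z0K z0max] := cone_slice_max su.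
have z0G := cone_slice_Gamma z0K.
(* All derivatives are taken of the extension [g], which is smooth on a full neighbourhood of [z0]
   even if [z0] lies on the boundary. *)
have [g [U [oU Uz0 sg gu]] gw] := hw z0 z0G.
pose G l : 'rV[R]_(1 + d) -> R^o := fun y => g y 0 l.
have sG l : smooth_on_open U (G l) by exact: smooth_on_open_component.
pose T : 'rV[R]_(1 + d) := delta_mx 0 (lshift d ord0).
pose W := z0 - T.
pose x i : R := z0 0 (rshift 1 i).
pose r2 := \sum_i x i ^+ 2.
have r2_le1 : r2 <= 1 := z0K.2.
have time_eq l : hess_form (G l) z0 T T = hess_form (G l) z0 W W
    + 2 * (k + 1) * gradient_form (G l) z0 W + k * (k + 1) * G l z0.
  apply: (second_derivative_scaling oU (sG l) Uz0).
  have U1 := near_quadratic_curve T (- W) oU Uz0.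
  have U2 := near_quadratic_curve (- W) 0 oU Uz0.
  apply: filterS3 (near0_le (ltr01 : (0 : R) < 1)) U1 U2 => s + Us1 Us2 s0.
  rewrite ger0_norm// => s1.
  have s10 : 0 < 1 + s by rewrite ltr_pwDl.
  rewrite scaler0 addr0 scalerN in Us2.
  (* The space part is x scaled by 1 - s, which lies in [0, 1]. *)
  have zs : cone_slice (z0 - s *: W).
    split.
      by rewrite mxE z0K.1 mxE mxE (radial_time z0K) mulr0 subr0.
    apply: le_trans r2_le1; apply: ler_sum => i _.
    rewrite mxE mxE mxE radial_space -/(x i).
    have -> : (x i - s * x i) ^+ 2 = (1 - s) ^+ 2 * x i ^+ 2 by ring.
    rewrite -[leRHS]mul1r ler_wpM2r ?sqr_ge0// expr_le1// ?subr_ge0//.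
    by rewrite gerBl.
  have E : z0 + s *: T + s ^+ 2 *: - W = (1 + s) *: (z0 - s *: W).
    rewrite /W; apply/rowP => j; rewrite !mxE; ring.
  rewrite E in Us1 *.
  have zsG := cone_slice_Gamma zs.
  by rewrite /G !gu//; [rewrite hu// mxE|exact: Gamma_scale].
have wave_eq l : - hess_form (G l) z0 T T
    + \sum_i partial (rshift 1 i) (partial (rshift 1 i) (G l)) z0
    = grad F (u z0) 0 l.
  have D2 i : partial i (partial i (G l)) z0 = partial i (partial i g) z0 0 l.
    exact: (iter_partial_component l [:: i; i] oU sg Uz0).
  rewrite -gw /box hess_form_delta D2 mxE mxE summxE.
  by congr (_ + _); apply: eq_bigr => i _; exact: D2.
(* The root of r2 c^2 - 2 c + 1 that remains finite at r2 = 0. *)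
pose c : R := (1 + Num.sqrt (1 - r2))^-1.
have cE : c ^+ 2 * r2 - 2 * c + 1 = 0.
  have q0 : 1 + Num.sqrt (1 - r2) != 0 by rewrite gt_eqF// ltr_pwDl// sqrtr_ge0.
  have q2 : r2 = 1 - Num.sqrt (1 - r2) ^+ 2.
    by rewrite sqr_sqrtr ?subr_ge0// opprB addrC subrK.
  rewrite /c; move: q0; rewrite [X in _ * X - _]q2.
  move: (Num.sqrt _) => q q0; by field.
have dr2 : 0 < d%:R - r2.
  by rewrite subr_gt0 (le_lt_trans r2_le1)// ltr1n (leq_trans _ hd).
pose kappa := (2 * k + 2) / (d%:R - r2).
(* At r2 = 1 this says 2 k + 2 > d - 1, which is [hdp]. *)
have kappa1 : r2 = 1 -> 1 < kappa.
  move=> r1; rewrite /kappa ltr_pdivlMr// mul1r r1; lra.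
pose A i := delta_mx 0 (rshift 1 i) - (c * x i) *: W.
pose B i := - (kappa / 2 * (1 - x i ^+ 2)) *: W.
have max_test i : \sum_l G l z0 *
    (2 * gradient_form (G l) z0 (B i) + hess_form (G l) z0 (A i) (A i)) <= 0.
  apply: (sum_sqr_local_max oU sG Uz0).
  have U1 := near_quadratic_curve (A i) (B i) oU Uz0.
  have ball := frame_curve_in_ball r2_le1 cE i kappa1.
  apply: filterS2 U1 ball => s Us bs.
  have zs : cone_slice (z0 + s *: A i + s ^+ 2 *: B i).
    split; first by rewrite quadratic_curve_coord (radial_time z0K) z0K.1 mxE eq_lrshift andbF !mulr0 !subr0 mulr0 addr0.
    apply: le_trans bs; apply: ler_sum => j _.
    by rewrite quadratic_curve_coord radial_space mxE eqxx eq_rshift.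
  have GE y : U y -> cone_slice y -> \sum_l G l y ^+ 2 = \sum_l u y 0 l ^+ 2.
    move=> Uy yK; apply: eq_bigr => l _; rewrite /G gu//.
    exact: cone_slice_Gamma.
  by rewrite !GE//; exact: z0max.
have : \sum_i \sum_l G l z0 *
    (2 * gradient_form (G l) z0 (B i) + hess_form (G l) z0 (A i) (A i)) <= 0.
  by rewrite -oppr_ge0 -sumrN sumr_ge0// => i _; rewrite oppr_ge0.
rewrite exchange_big/=.
(* The choice of [kappa] makes the curvature terms add up to the first-order radial term of
   [time_eq], which therefore cancels in [E]. *)
have sumB (D : R) :
    \sum_i 2 * (- (kappa / 2 * (1 - x i ^+ 2)) * D) = - (2 * k + 2) * D.
  have sumE : \sum_i (1 - x i ^+ 2) = d%:R - r2.
    by rewrite sumrB sumr_const card_ord.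
  have -> : 2 * k + 2 = kappa * \sum_i (1 - x i ^+ 2).
    by rewrite sumE /kappa divfK// gt_eqF.
  rewrite mulNr mulr_sumr mulr_suml -sumrN; apply: eq_bigr => i _.
  by field.
have E l : \sum_i G l z0 *
    (2 * gradient_form (G l) z0 (B i) + hess_form (G l) z0 (A i) (A i)) =
    u z0 0 l * grad F (u z0) 0 l + k * (k + 1) * u z0 0 l ^+ 2.
  have GE : G l z0 = u z0 0 l by rewrite /G gu.
  rewrite -mulr_sumr big_split/= (sum_hess_form_frame z0K _ cE).
  rewrite /B; under eq_bigr do rewrite gradient_formZ.
  rewrite sumB -wave_eq -GE time_eq; ring.
rewrite (eq_bigr _ (fun l _ => E l)) big_split/= (euler_homogeneous hF hFhom)//; last exact: u0.
(* (p + 1) F(u) is positive and the other sum is nonnegative, so the total cannot be at most 0. *)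
apply/negP; rewrite -ltNge ltr_pwDl//.
  by rewrite mulr_gt0 ?addr_gt0 ?hFpos ?u0// (lt_trans ltr01 hp).
have kk : 0 <= k * (k + 1) by rewrite mulr_ge0 ?addr_ge0// ltW.
by rewrite sumr_ge0// => l _; rewrite mulr_ge0// sqr_ge0.
Qed.
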